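(* Let $n$ be a positive integer, and let $H(2n)=\big(h(i,j)\big)_{1\leq i\leq 2n,\,j\geq 1}$ be the matrix with $2n$ rows and infinitely many columns whose entries are given, for $k\geq 1$, by $$h(i,2k-1)=\binom{i-1}{k-1}\,{}_2F_1\!\left(\tfrac{k-i}{2},\tfrac{k-i+1}{2};k+1;4\right),$$ $$h(i,2k)=(i-1)\binom{i-2}{k-1}\,{}_2F_1\!\left(\tfrac{k-i+1}{2},\tfrac{k-i+2}{2};k+1;4\right).$$ Then $$\sum_{\lambda}\det H(2n)_{I_{2n}(\lambda)}=\prod_{k=0}^{n-1}(4k+1),$$ where the sum runs over all even partitions $\lambda$ of length $\ell(\lambda)\leq 2n$ whose conjugate $\lambda'$ is also even.
   Context: Here ${}_2F_1(a,b;c;z)=\sum_{m\ge 0}\frac{(a)_m(b)_m}{(c)_m\,m!}z^m$ is the Gauss hypergeometric function, with $(a)_m=a(a+1)\cdots(a+m-1)$. An entry $h(i,j)$ is understood to be $0$ whenever its prefactor vanishes, i.e. $h(i,2k-1)=0$ for $k>i$ and $h(i,2k)=0$ for $k>i-1$ (in particular $h(1,2k)=0$ for all $k\ge1$); in all other cases the hypergeometric series terminates. Equivalently, $h(i,2k-1)$ is the number of Motzkin paths from $(0,0)$ to $(i-1,k-1)$ (lattice paths with steps $(1,1),(1,0),(1,-1)$ never going below the horizontal axis), and $h(i,2k)=k\,[x^{i+k-1}](1+x+x^2)^{i-1}$, where $[x^m]f(x)$ is the coefficient of $x^m$ in $f(x)$. For example, $$H(4)=\begin{pmatrix}1&0&0&0&0&0&0&0&\cdots\\1&1&1&0&0&0&0&0&\cdots\\2&2&2&2&1&0&0&0&\cdots\\4&6&5&6&3&3&1&0&\cdots\end{pmatrix}.$$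 A partition is a nonincreasing sequence $\lambda=(\lambda_1,\lambda_2,\dots)$ of nonnegative integers with only finitely many nonzero elements; its length $\ell(\lambda)$ is the number of nonzero elements. A partition is even if all its parts are even (the empty partition is even). The conjugate $\lambda'=(\lambda'_1,\lambda'_2,\dots)$ is given by $\lambda'_i=\#\{j\mid\lambda_j\geq i\}$. For a partition $\lambda$ with $\ell(\lambda)\leq N$, put $$I_N(\lambda)=\{\lambda_N+1,\lambda_{N-1}+2,\dots,\lambda_1+N\},$$ an $N$-element set of positive integers. For an $N$-rowed matrix $A=(a_{i,j})_{1\le i\le N,\,j\ge1}$ and an $N$-element set $J$ of column indices, $A_J$ denotes the $N\times N$ submatrix formed by the columns indexed by $J$, taken in increasing order. Only finitely many terms of the sum in the claim are nonzero, since $H(2n)$ has only finitely many nonzero columns. *)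

(* Defs.v *)
From mathcomp Require Import all_boot all_order all_algebra.
From mathcomp Require Import all_classical all_reals all_analysis.
Import Order.TTheory GRing.Theory Num.Theory.
Import numFieldNormedType.Exports.

Set Implicit Arguments.
Unset Strict Implicit.
Unset Printing Implicit Defensive.

Local Open Scope ring_scope.

Definition pochhammer (R : realType) (a : R) (m : nat) : R :=
  \prod_(i < m) (a + i%:R).

Definition hyp2F1 (R : realType) (a b c z : R) : R :=
  limn (series (fun m : nat =>
    pochhammer a m * pochhammer b m / (pochhammer c m * m`!%:R) * z ^+ m)).

(* Rows and columns are numbered from 1.  Both for j = 2k-1 and for j = 2k one
   has uphalf j = k.  When the binomial prefactor vanishes the series may
   diverge; its limit is then an unspecified real, so that the entry is 0. *)
Definition h (R : realType) (i j : nat) : R :=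
  let k := uphalf j in
  let x : R := k%:R - i%:R in
  if odd j then
    'C(i - 1, k - 1)%:R * hyp2F1 (x / 2) ((x + 1) / 2) (k%:R + 1) 4
  else
    ((i - 1) * 'C(i - 2, k - 1))%:R *
      hyp2F1 ((x + 1) / 2) ((x + 2) / 2) (k%:R + 1) 4.

(* An N-rowed matrix with infinitely many columns is a function
   'I_N -> nat -> R whose second argument is the column number, from 1. *)
Definition H (R : realType) (N : nat) : 'I_N -> nat -> R :=
  fun i j => h R i.+1 j.

(* The finite set J of column numbers is given by a list of its elements;
   columns are taken in increasing order.  Meaningful when J has N distinct
   elements. *)
Definition subcols (R : realType) (N : nat) (A : 'I_N -> nat -> R)
    (J : seq nat) : 'M[R]_N :=
  \matrix_(r < N, s < N) A r (nth 0%N (sort leq J) s).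

(* A partition is encoded by the list of its nonzero parts, in nonincreasing
   order; thus lambda_i = nth 0 l (i - 1) and the length is size l. *)
Definition is_partition (l : seq nat) : bool :=
  sorted geq l && all (leq 1) l.

Definition even_partition (l : seq nat) : bool := all (fun p => ~~ odd p) l.

(* lambda'_i = #{j | lambda_j >= i} vanishes for i > lambda_1 = head 0 l. *)
Definition conjugate (l : seq nat) : seq nat :=
  [seq count (leq i) l | i <- iota 1 (head 0%N l)].

(* The list lambda_N + 1, lambda_{N-1} + 2, ..., lambda_1 + N. *)
Definition index_set (N : nat) (l : seq nat) : seq nat :=
  [seq (nth 0%N l (N - s) + s)%N | s <- iota 1 N].

(* Main.v *)
From mathcomp Require Import fingroup perm.
Require Import Defs.
From mathcomp Require Import all_boot all_order all_algebra.
From mathcomp Require Import all_classical all_reals all_analysis.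
From mathcomp Require Import perm zify ring lra.

(* With [y = x - 1 = z + 1/z] and [t_k = z^k + z^-k] (but [t_0 = 1]),
   [x^N = sum_k c(N,k) t_k] with unitriangular trinomial coefficients [c(N,k)].
   Row [N + 1] of [H] lists the coordinates of [x^N] (odd columns) and of its
   derivative (even columns) in the basis [U_k] of Chebyshev polynomials of the
   second kind, so [H = c A], where row [r] of [A] does the same for [t_r], with
   [t_r = U_r - U_(r-2)] and [t_r' = r U_(r-1)].  The partitions of the sum
   select unions of [n] column pairs [(2k-1, 2k)].  If [X], [Y] consist of the
   odd and of the even columns of [A], the sum of these minors is the Pfaffian
   of [X Y^T - Y X^T], hence depends only on this skew matrix, which is
   tridiagonal with entries [2r + 1] next to the diagonal.  The same matrix
   comes from a lower triangular matrix with a single such minor, whose diagonal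
   entries are [1, 1, 5, 1, 9, 1, ...]. *)

Import Order.TTheory GRing.Theory Num.Theory.
Import numFieldNormedType.Exports.

Set Implicit Arguments.
Unset Strict Implicit.
Unset Printing Implicit Defensive.

Local Open Scope ring_scope.

(** * Pairs of adjacent columns and the permutations that move them as blocks *)

Section PairedColumns.
Variable n : nat.

(** Together, [dbl] and its inverse ([half_ord] and the parity) identify ['I_(2 * n)] with
    ['I_n * bool]; [b] tells the first column of pair [t] from the second. *)
Lemma dbl_subproof (t : 'I_n) (b : bool) : (2 * t + b < 2 * n)%N.
Proof. by case: t b => t lt_tn [] /=; lia. Qed.
Definition dbl (t : 'I_n) (b : bool) : 'I_(2 * n) := Ordinal (dbl_subproof t b).

Lemma half_ord_subproof (s : 'I_(2 * n)) : (s./2 < n)%N.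
Proof. by case: s => s lt_s /=; lia. Qed.
Definition half_ord (s : 'I_(2 * n)) : 'I_n := Ordinal (half_ord_subproof s).

Lemma dbl_half_ord s : dbl (half_ord s) (odd s) = s.
Proof. by apply/val_inj => /=; lia. Qed.

Lemma half_ord_dbl t b : half_ord (dbl t b) = t.
Proof. by apply/val_inj => /=; case: b; lia. Qed.

Lemma odd_dbl t b : odd (dbl t b) = b.
Proof. by case: b => /=; lia. Qed.

Lemma big_dbl (R : Type) (idx : R) (op : Monoid.com_law idx)
    (F : 'I_(2 * n) -> R) :
  \big[op/idx]_s F s = \big[op/idx]_t op (F (dbl t false)) (F (dbl t true)).
Proof.
rewrite (reindex (fun p : 'I_n * bool => dbl p.1 p.2)) /=; last first.
  exists (fun s => (half_ord s, odd s)) => [[t b]|s] _ /=.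
    by rewrite half_ord_dbl odd_dbl.
  exact: dbl_half_ord.
rewrite -(pair_bigA _ (fun t b => F (dbl t b))) /=.
by apply: eq_bigr => t _; rewrite big_bool Monoid.mulmC.
Qed.

Definition dbl_perm_fun (p : 'S_n) (s : 'I_(2 * n)) := dbl (p (half_ord s)) (odd s).

Lemma dbl_perm_inj p : injective (dbl_perm_fun p).
Proof.
move=> s s' eq_ss'; rewrite -(dbl_half_ord s) -(dbl_half_ord s').
have := congr1 half_ord eq_ss'; rewrite !half_ord_dbl => /perm_inj ->.
by have := congr1 (fun s : 'I_(2 * n) => odd s) eq_ss'; rewrite !odd_dbl => ->.
Qed.

Definition dbl_perm p : 'S_(2 * n) := perm (@dbl_perm_inj p).

Lemma dbl_permE p t b : dbl_perm p (dbl t b) = dbl (p t) b.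
Proof. by rewrite permE /dbl_perm_fun half_ord_dbl odd_dbl. Qed.

Lemma dbl_perm1 : dbl_perm 1%g = 1%g.
Proof.
by apply/permP => s; rewrite -(dbl_half_ord s) dbl_permE !perm1.
Qed.

Lemma dbl_permM p q : dbl_perm (p * q)%g = (dbl_perm p * dbl_perm q)%g.
Proof.
by apply/permP => s; rewrite -(dbl_half_ord s) permM !dbl_permE permM.
Qed.

Lemma eq_dbl t b t' b' : (dbl t b == dbl t' b') = (t == t') && (b == b').
Proof. by rewrite -!val_eqE /=; case: b b' => [] []; lia. Qed.

Lemma tperm_dbl i j t b :
  tperm (dbl i b) (dbl j b) (dbl t b) = dbl (tperm i j t) b.
Proof.
have dblI : injective (dbl^~ b) by move=> x y /(congr1 half_ord); rewrite !half_ord_dbl.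
by rewrite (inj_tperm _ _ _ dblI).
Qed.

Lemma dbl_perm_tperm i j : dbl_perm (tperm i j) =
  (tperm (dbl i false) (dbl j false) * tperm (dbl i true) (dbl j true))%g.
Proof.
apply/permP => s; rewrite -(dbl_half_ord s) permM dbl_permE.
case: (odd s); first by rewrite (tpermD (z := dbl _ true)) ?eq_dbl ?andbF ?tperm_dbl.
by rewrite tperm_dbl (@tpermD _ (dbl i true)) ?eq_dbl ?andbF.
Qed.

(** A transposition of two pairs is a product of two transpositions of columns, so its signs cancel;
    such transpositions generate all [dbl_perm p]. *)
Lemma odd_dbl_perm p : odd_perm (dbl_perm p) = false.
Proof.
case: (prod_tpermP p) => ts -> _; elim: ts => [|[i j] ts IHts].
  by rewrite big_nil dbl_perm1 odd_perm1.
rewrite big_cons dbl_permM odd_permM IHts dbl_perm_tperm odd_permM !odd_tperm.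
by rewrite !eq_dbl !andbT addbb.
Qed.

(** * Sums of paired minors as Pfaffians *)

Variable F : numFieldType.

(** [f] may be any function: the sum over all selections factors over the pairs, and repeated pairs
    contribute 0. *)
Definition pair_cols m (X Y : 'M[F]_(2 * n, m)) (f : 'I_n -> 'I_m) :
    'M[F]_(2 * n) :=
  \matrix_(r, s) (if odd s then Y else X) r (f (half_ord s)).

Lemma pair_cols_mulmx m (C : 'M[F]_(2 * n)) (X Y : 'M[F]_(2 * n, m)) f :
  pair_cols (C *m X) (C *m Y) f = C *m pair_cols X Y f.
Proof.
apply/matrixP => r s; rewrite mxE [RHS]mxE; case: ifP => os;
  by rewrite mxE; apply: eq_bigr => k _; rewrite [pair_cols _ _ _ _ _]mxE os.
Qed.

Lemma det_pair_cols_noninj m (X Y : 'M[F]_(2 * n, m)) (f : 'I_n -> 'I_m) :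
  ~ injective f -> \det (pair_cols X Y f) = 0.
Proof.
move/injectiveP/injectivePn => [i [j nij fij]].
rewrite -det_tr; apply: (determinant_alternate (i1 := dbl i false) (i2 := dbl j false)).
  by rewrite eq_dbl andbT.
by move=> r; rewrite !mxE !odd_dbl !half_ord_dbl fij.
Qed.

Lemma det_pair_cols_perm m (X Y : 'M[F]_(2 * n, m)) (f : 'I_n -> 'I_m) (p : 'S_n) :
  \det (pair_cols X Y (f \o p)) = \det (pair_cols X Y f).
Proof.
have -> : pair_cols X Y (f \o p) = col_perm (dbl_perm p) (pair_cols X Y f).
  apply/matrixP => r s; rewrite !mxE -{3 4}(dbl_half_ord s) dbl_permE.
  by rewrite odd_dbl half_ord_dbl.
by rewrite col_permE det_mulmx det_perm odd_permV odd_dbl_perm mulr1.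
Qed.

(* For [P] constant, this is [n!] times the Pfaffian of [P - P^T]. *)
Definition pfsum (P : 'I_n -> 'M[F]_(2 * n)) : F :=
  \sum_(p : 'S_(2 * n)) (-1) ^+ p * \prod_t P t (p (dbl t false)) (p (dbl t true)).

(** In the Leibniz expansion, for a fixed [p], pair [t] contributes a factor that depends on [f t]
    alone. Summing over [f] therefore turns the product into a product of entries of [X *m Y^T]. *)
Lemma sum_det_pair_cols m (X Y : 'M[F]_(2 * n, m)) :
  \sum_(f : {ffun 'I_n -> 'I_m}) \det (pair_cols X Y f)
  = pfsum (fun=> X *m Y^T).
Proof.
under eq_bigr => f _ do rewrite -det_tr.
rewrite exchange_big /=; apply: eq_bigr => p _.
rewrite -big_distrr /=; congr (_ * _).
under [RHS]eq_bigr => t _ do rewrite mxE.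
rewrite bigA_distr_bigA /=; apply: eq_bigr => f _.
by rewrite big_dbl; apply: eq_bigr => t _; rewrite !mxE !odd_dbl !half_ord_dbl.
Qed.

(** Exchanging the two arguments of slot [t0] reverses the sign of [p] but leaves the product
    unchanged, so the sum equals its own negative. *)
Lemma pfsum_sym (P : 'I_n -> 'M[F]_(2 * n)) t0 : (P t0)^T = P t0 -> pfsum P = 0.
Proof.
move=> symP; have: pfsum P = - pfsum P.
  rewrite {1}/pfsum (reindex_inj (mulgI (tperm (dbl t0 false) (dbl t0 true)))) /=.
  rewrite -sumrN; apply: eq_bigr => p _.
  rewrite odd_permM odd_tperm eq_dbl andbF /= signrN mulNr; congr (- (_ * _)).
  apply: eq_bigr => t _; rewrite !permM.
  have [->|ntt0] := eqVneq t t0; first by rewrite tpermL tpermR -{2}symP mxE.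
  by rewrite !tpermD // eq_dbl negb_and eq_sym ntt0.
by move/eqP; rewrite -addr_eq0 -mulr2n mulrn_eq0 /= => /eqP.
Qed.

(* A symmetric summand in a single slot contributes nothing, so the slots may
   be exchanged one at a time. *)
Lemma eq_pfsum_asym (P Q : 'M[F]_(2 * n)) :
  P - P^T = Q - Q^T -> pfsum (fun=> P) = pfsum (fun=> Q).
Proof.
move=> eqPQ.
pose mix j (t : 'I_n) := if (t < j)%N then Q else P.
have step j : (j < n)%N -> pfsum (mix j) = pfsum (mix j.+1).
  move=> lt_jn; pose t0 := Ordinal lt_jn.
  apply/eqP; rewrite -subr_eq0; apply/eqP.
  (* By linearity in slot [j], the difference is the sum with [P - Q] in that slot, and the
     hypothesis says that [P - Q] is symmetric. *)
  rewrite -[RHS](@pfsum_sym (fun t => if t == t0 then P - Q else mix j t) t0).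
    rewrite -sumrB; apply: eq_bigr => p _; rewrite -mulrBr; congr (_ * _).
    rewrite [X in X - _](bigD1 t0) //= [X in _ - X](bigD1 t0) //= [RHS](bigD1 t0) //=.
    rewrite {1}/mix {2}/mix ltnn ltnSn eqxx.
    rewrite [X in _ - _ * X](eq_bigr (fun t => mix j t (p (dbl t false)) (p (dbl t true)))).
      rewrite [X in _ = _ * X](eq_bigr (fun t => mix j t (p (dbl t false)) (p (dbl t true)))).
        by rewrite -mulrBl !mxE.
      by move=> t /negbTE ->.
    move=> t; rewrite -val_eqE /= => ntj; rewrite /mix ltnS leq_eqVlt.
    by rewrite (negbTE ntj).
  have trP : P^T = P - (Q - Q^T) by rewrite -eqPQ opprB addrCA subrr addr0.
  by rewrite eqxx linearB /= trP; apply/matrixP => i k; rewrite !mxE; ring.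
have mixE j : (j <= n)%N -> pfsum (mix j) = pfsum (mix 0%N).
  by elim: j => // j IHj lt_jn; rewrite -step // IHj // ltnW.
transitivity (pfsum (mix 0%N)); first by [].
rewrite -(mixE n) //; apply: eq_bigr => p _; congr (_ * _).
by apply: eq_bigr => t _; rewrite /mix ltn_ord.
Qed.

(** * Increasing selections as representatives of injective ones *)

Definition increasing m (f : 'I_n -> 'I_m) :=
  [forall i : 'I_n, forall j : 'I_n, (i < j)%N ==> (f i < f j)%N].

Lemma increasingP m (f : 'I_n -> 'I_m) :
  reflect (forall i j : 'I_n, (i < j)%N -> (f i < f j)%N) (increasing f).
Proof.
apply: (iffP forallP) => [fP i j|fP i]; first by move/forallP/(_ j)/implyP: (fP i).
by apply/forallP=> j; apply/implyP/fP.
Qed.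

Lemma increasing_inj m (f : 'I_n -> 'I_m) : increasing f -> injective f.
Proof.
move/increasingP=> incf i j fij; apply/val_inj/eqP.
by case: (ltngtP i j) => // /incf; rewrite fij ltnn.
Qed.

Lemma increasing_sorted m (f : 'I_n -> 'I_m) :
  increasing f -> sorted (fun i j : 'I_m => (i < j)%N) [seq f i | i <- enum 'I_n].
Proof.
move/increasingP=> incf; rewrite sorted_map.
apply: (sub_sorted (e := fun i j : 'I_n => (i < j)%N)) => //.
by have := iota_ltn_sorted 0 n; rewrite -val_enum_ord sorted_map.
Qed.

(** Both compositions list the image of [f] in strictly increasing order, and a set has only one
    such list; injectivity of [f] then gives [p = q]. *)
Lemma increasing_uniq m (f : 'I_n -> 'I_m) (p q : 'S_n) :
  increasing (f \o p) -> increasing (f \o q) -> p = q.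
Proof.
move=> incp incq; have injf : injective f.
  move=> i j; rewrite -(permKV p i) -(permKV p j) => /(increasing_inj incp) ->.
  by [].
have perm_codom (s : 'S_n) : perm_eq [seq s i | i <- enum 'I_n] (enum 'I_n).
  apply: uniq_perm => [||i]; rewrite ?enum_uniq //.
    by rewrite map_inj_uniq ?enum_uniq //; exact: perm_inj.
  rewrite mem_enum; apply/mapP; exists ((s^-1)%g i); rewrite ?mem_enum //.
  by rewrite permKV.
have: [seq (f \o p) i | i <- enum 'I_n] = [seq (f \o q) i | i <- enum 'I_n].
  apply: (irr_sorted_eq (leT := fun i j : 'I_m => (i < j)%N)).
  - by move=> j i k; apply: ltn_trans.
  - by move=> i; rewrite /= ltnn.
  - exact: increasing_sorted.
  - exact: increasing_sorted.
  have perm_pq : perm_eq [seq p i | i <- enum 'I_n] [seq q i | i <- enum 'I_n].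
    by rewrite (perm_trans (perm_codom p)) // perm_sym.
  have := perm_map f perm_pq; rewrite -!map_comp.
  exact: perm_mem.
move/eq_in_map => epq; apply/permP => i; apply: injf.
by apply: epq; rewrite mem_enum.
Qed.

Lemma increasing_exists m (f : 'I_n -> 'I_m) :
  injective f -> exists p : 'S_n, increasing (f \o p).
Proof.
move=> injf; pose le := fun i j : 'I_m => (i <= j)%N.
pose t := [tuple f i | i < n].
have: perm_eq (sort le t) t by rewrite perm_sort.
(* The permutation is the one that sorts the values of [f]; as these are distinct, the sorted list
   is strictly increasing. *)
case/tuple_permP => p def_s; exists p.
have uniq_s : uniq (sort le t).
  by rewrite sort_uniq map_inj_uniq // enum_uniq.
have sorted_s : sorted le (sort le t) by apply: sort_sorted => i j; apply: leq_total.
have: sorted (fun i j : 'I_m => (i < j)%N) (sort le t).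
  have := ltn_sorted_uniq_leq [seq val i | i <- sort le t].
  by rewrite !sorted_map map_inj_uniq ?uniq_s //=; [move=> -> | exact: val_inj].
rewrite def_s; set u := mktuple _ => sorted_u; apply/increasingP => i j lt_ij.
have := @sorted_ltn_nth _ (fun i j : 'I_m => (i < j)%N) (fun _ _ _ => @ltn_trans _ _ _)
  (f i) _ sorted_u i j.
by rewrite !inE !size_tuple -!tnth_nth !tnth_mktuple; apply.
Qed.

(** Each injective [f] has exactly one [p] with [f \o p] increasing. Summing over the pairs [(f, p)]
    and exchanging the sums, each of the [n!] permutations contributes the sum over increasing
    selections. *)
Lemma sum_increasing m (G : ('I_n -> 'I_m) -> F) :
    (forall f g, f =1 g -> G f = G g) ->
    (forall f, ~ injective f -> G f = 0) ->
    (forall f (p : 'S_n), G (f \o p) = G f) ->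
  \sum_(f : {ffun 'I_n -> 'I_m}) G f
  = n`!%:R * \sum_(f : {ffun 'I_n -> 'I_m} | increasing f) G f.
Proof.
move=> extG G0 Gp.
transitivity (\sum_(f : {ffun 'I_n -> 'I_m}) \sum_(p : 'S_n | increasing (f \o p)) G f).
  apply: eq_bigr => f _; case: (boolP (injectiveb f)) => [/injectiveP injf|/injectiveP ninjf].
    have [p incp] := increasing_exists injf.
    rewrite (big_pred1 p) // => q; apply/idP/eqP => [incq|-> //].
    exact: increasing_uniq incq incp.
  by rewrite G0 // big1.
rewrite (exchange_big_dep predT) //=.
rewrite -card_Sn mulr_natl -sumr_const.
apply: eq_big => [p|p _]; first by rewrite inE.
pose act (q : 'S_n) (f : {ffun 'I_n -> 'I_m}) := [ffun i => f (q i)].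
have actK q : cancel (act q) (act q^-1%g).
  by move=> f; apply/ffunP => i; rewrite !ffunE permKV.
rewrite (reindex_inj (can_inj (actK p^-1%g))) /=.
apply: eq_big => [f|f _].
  have e i : (act p^-1%g f \o p) i = f i by rewrite /= ffunE permK.
  by apply: eq_forallb => i; apply: eq_forallb => j; rewrite !e.
by rewrite -(Gp f p^-1%g); apply: extG => i; rewrite ffunE.
Qed.

Lemma sum_det_increasing m (X Y : 'M[F]_(2 * n, m)) :
  pfsum (fun=> X *m Y^T)
  = n`!%:R * \sum_(f : {ffun 'I_n -> 'I_m} | increasing f) \det (pair_cols X Y f).
Proof.
rewrite -sum_det_pair_cols (sum_increasing (G := fun f => \det (pair_cols X Y f))) //.
- by move=> f g efg; congr (\det _); apply/matrixP => r s; rewrite !mxE efg.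
- exact: det_pair_cols_noninj.
- exact: det_pair_cols_perm.
Qed.

(** Viewed as permutations, [f] and the identity both sort the identity map, so uniqueness
    applies. *)
Lemma increasing_id (f : 'I_n -> 'I_n) : increasing f -> f =1 id.
Proof.
move=> incf; have injf := increasing_inj incf.
have := @increasing_uniq n id (perm injf) 1%g.
have e (p : 'S_n) g : p =1 g -> increasing g -> increasing (id \o p).
  move=> epg /increasingP incg; apply/increasingP => i j lt_ij /=.
  by rewrite !epg incg.
rewrite (e _ f) ?(e _ id) => [/(_ isT isT) e1 i||||].
- by rewrite -[f i](permE injf) e1 perm1.
- by move=> i; rewrite perm1.
- exact/increasingP.
- by move=> i; rewrite permE.
- by [].
Qed.

(** Multiplied by [n!], both sides become values of [pfsum] with the same antisymmetric part. With
    just [n] pairs on the right, the identity is the only increasing selection. *)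
Lemma eq_sum_det_increasing m (X Y : 'M[F]_(2 * n, m)) (X' Y' : 'M[F]_(2 * n, n)) :
    X *m Y^T - (X *m Y^T)^T = X' *m Y'^T - (X' *m Y'^T)^T ->
  \sum_(f : {ffun 'I_n -> 'I_m} | increasing f) \det (pair_cols X Y f)
  = \det (pair_cols X' Y' id).
Proof.
move=> asymE; have nfact_neq0 : n`!%:R != 0 :> F by rewrite pnatr_eq0 -lt0n fact_gt0.
apply: (mulfI nfact_neq0).
rewrite -sum_det_increasing (eq_pfsum_asym asymE) sum_det_increasing; congr (_ * _).
rewrite (big_pred1 (finfun id)) => [|f /=].
  by congr (\det _); apply/matrixP => r s; rewrite !mxE ffunE.
apply/idP/eqP => [/increasing_id e|->]; first by apply/ffunP => i; rewrite ffunE e.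
by apply/increasingP => i j; rewrite !ffunE.
Qed.

(** * The Chebyshev matrices and a triangular model with the same skew matrix *)

(* Coordinates of [t_r] and of its derivative in the basis [U_k]. *)
Definition chebX : 'M[F]_(2 * n) :=
  \matrix_(r, k) ((r == k :> nat)%N%:R - (r == k.+2 :> nat)%N%:R).
Definition chebY : 'M[F]_(2 * n) :=
  \matrix_(r, k) (k.+1 * (r == k.+1 :> nat)%N)%:R.

(** The product [triX *m triY^T] puts both off-diagonal entries of the skew matrix into its even
    rows and leaves the odd rows zero. The truncation of [2 * r - 1] at [r = 0] is harmless, since
    the indicator vanishes there. *)
Definition triX : 'M[F]_(2 * n, n) :=
  \matrix_(r < 2 * n, k < n) (((2 * r + 1) * (r == 2 * k :> nat)%N)%:R
    - ((2 * r - 1) * (r == 2 * k.+1 :> nat)%N)%:R).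
Definition triY : 'M[F]_(2 * n, n) :=
  \matrix_(r < 2 * n, k < n) (r == (2 * k).+1 :> nat)%N%:R.

Lemma chebXY r s : (chebX *m chebY^T) r s = 
  s%:R * ((s == r.+1 :> nat)%N%:R - (r == s.+1 :> nat)%N%:R).
Proof.
rewrite mxE; case: s => [[|s]] lt_s /=.
  by rewrite mul0r big1 // => k _; rewrite !mxE /= muln0 mulr0.
rewrite (bigD1 (Ordinal (ltnW lt_s))) //= big1 => [|k nk].
  by rewrite !mxE /= eqxx muln1 addr0 mulrC eqSS eq_sym.
rewrite !mxE /= eqSS; move: nk; rewrite -val_eqE /= eq_sym => /negbTE ->.
by rewrite muln0 mulr0.
Qed.

Lemma triXY r s : (triX *m triY^T) r s = if odd r then 0 else
   (2 * r + 1)%:R * (s == r.+1 :> nat)%N%:R - (2 * r - 1)%:R * (r == s.+1 :> nat)%N%:R.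
Proof.
rewrite mxE.
have -> : \sum_j triX r j * triY^T j s =
  if odd s then triX r (half_ord s) else 0.
  case: ifP => os.
    rewrite (bigD1 (half_ord s)) //= big1 => [|k nk].
      rewrite addr0 [triY^T _ _]mxE [triY _ _]mxE /=.
      have -> : (s == (2 * s./2).+1 :> nat)%N by lia.
      by rewrite mulr1.
    rewrite [triY^T _ _]mxE [triY _ _]mxE; move: nk; rewrite -val_eqE /= => nk.
    have -> : (s == (2 * k).+1 :> nat)%N = false by lia.
    by rewrite mulr0.
  rewrite big1 // => k _.
  rewrite [triY^T _ _]mxE [triY _ _]mxE /=.
  have -> : (s == (2 * k).+1 :> nat)%N = false by lia.
  by rewrite mulr0.
rewrite !mxE /= -!natrM.
case: (boolP (odd r)) => or; case: (boolP (odd s)) => os.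
- have -> : (r == 2 * s./2 :> nat)%N = false by lia.
  have -> : (r == 2 * s./2.+1 :> nat)%N = false by lia.
  by rewrite !muln0 subrr.
- by [].
- have -> : (r == 2 * s./2 :> nat)%N = (s == r.+1 :> nat)%N by lia.
  by have -> : (r == 2 * s./2.+1 :> nat)%N = (r == s.+1 :> nat)%N by lia.
- have -> : (s == r.+1 :> nat)%N = false by lia.
  have -> : (r == s.+1 :> nat)%N = false by lia.
  by rewrite !muln0 subrr.
Qed.

(** At [(r, r + 1)] the left side is [(r + 1) - (- r)], while on the right a single term [2 r + 1]
    comes from whichever of the two rows is even. *)
Lemma cheb_tri_asym :
  chebX *m chebY^T - (chebX *m chebY^T)^T = triX *m triY^T - (triX *m triY^T)^T.
Proof.
apply/matrixP => r s.
have asymE (M : 'M[F]_(2 * n)) : (M - M^T) r s = M r s - M s r by rewrite !mxE.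
rewrite !asymE !chebXY !triXY.
have nE (k : nat) : (2 * k + 1)%:R = 2 * k%:R + 1 :> F by rewrite natrD natrM.
case: (eqVneq (s : nat) r.+1) => [e|n1].
  have -> : (r == s.+1 :> nat)%N = false by lia.
  have -> : odd s = ~~ odd r by lia.
  have e2 : (2 * r.+1 - 1 = 2 * r + 1)%N by lia.
  by case: (odd r); rewrite /= e ?e2 !nE -!natr1; ring.
case: (eqVneq (r : nat) s.+1) => [e|n2].
  have -> : odd r = ~~ odd s by lia.
  have e2 : (2 * s.+1 - 1 = 2 * s + 1)%N by lia.
  by case: (odd s); rewrite /= e ?e2 !nE -!natr1; ring.
by case: (odd r) (odd s) => [] [] /=; ring.
Qed.

Lemma det_tri : \det (pair_cols triX triY id) = \prod_(0 <= k < n) (4 * k + 1)%:R.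
Proof.
rewrite det_trig.
  rewrite big_dbl big_mkord; apply: eq_bigr => t _.
  rewrite !mxE !odd_dbl !half_ord_dbl !mxE /=.
  have -> : (2 * t + 0 == 2 * t)%N by lia.
  have -> : (2 * t + 0 == 2 * t.+1)%N = false by lia.
  have -> : (2 * t + 1 == (2 * t).+1)%N by lia.
  by rewrite muln0 muln1 subr0 mulr1; congr (_%:R); lia.
apply/is_trig_mxP => r s lt_rs; rewrite mxE.
case: (boolP (odd s)) => os; rewrite !mxE /=.
  by have -> : (r == (2 * s./2).+1 :> nat)%N = false by lia.
have -> : (r == 2 * s./2 :> nat)%N = false by lia.
have -> : (r == 2 * s./2.+1 :> nat)%N = false by lia.
by rewrite !muln0 subrr.
Qed.

Lemma sum_det_cheb :
  \sum_(f : {ffun 'I_n -> 'I_(2 * n)} | increasing f) \det (pair_cols chebX chebY f)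
  = \prod_(0 <= k < n) (4 * k + 1)%:R.
Proof. by rewrite (eq_sum_det_increasing cheb_tri_asym) det_tri. Qed.

End PairedColumns.

(** * Hypergeometric entries as trinomial coefficients *)

Section Entries.
Variable R : realType.

Lemma limn_series_eventually0 (u : nat -> R) N :
  (forall m, (N <= m)%N -> u m = 0) -> limn (series u) = \sum_(m < N) u m.
Proof.
move=> u0; rewrite -(big_mkord xpredT u); apply: (@lim_near_cst R) => //.
near=> k; rewrite /series /=.
have le_Nk : (N <= k)%N by near: k; exact: nbhs_infty_ge.
rewrite (big_cat_nat (n := N)) //= [X in _ + X]big_nat_cond.
by rewrite [X in _ + X]big1 ?addr0 // => m /andP[/andP[/u0]].
Unshelve. all: by end_near. Qed.

Lemma pochhammerS (a : R) m : pochhammer a m.+1 = pochhammer a m * (a + m%:R).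
Proof. by rewrite /pochhammer big_ord_recr. Qed.

(** Passing from [m] to [m + 1] multiplies both sides by [(d - 2 m) (d - 2 m - 1)]. *)
Lemma pochhammer_half (d m : nat) :
  pochhammer (- d%:R / 2 : R) m * pochhammer ((- d%:R + 1) / 2 : R) m * 4 ^+ m
  = (d ^_ (2 * m))%:R.
Proof.
elim: m => [|m IHm]; first by rewrite /pochhammer !big_ord0 !mulr1.
rewrite !pochhammerS exprS.
have -> : (2 * m.+1 = (2 * m).+2)%N by lia.
rewrite !ffactnSr !natrM -IHm.
(* Truncated subtraction differs from that of [R] once [d < 2 m], but then both sides already vanish
   at [m]. *)
have [lt_d|le_d] := ltnP (d) (2 * m).
  have z : (d ^_ (2 * m))%:R = 0 :> R by rewrite ffact_small.
  rewrite -IHm in z.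
  set p := pochhammer _ m in z *; set q := pochhammer _ m in z *.
  transitivity ((p * q * 4 ^+ m) * ((- d%:R / 2 + m%:R) * ((- d%:R + 1) / 2 + m%:R) * 4)).
    by ring.
  by rewrite z !mul0r.
have e1 : (d - 2 * m)%:R = d%:R - 2 * m%:R :> R by rewrite natrB // natrM.
have [le_d1|lt_d] := leqP ((2 * m).+1) d.
  have e2 : (d - (2 * m).+1)%:R = d%:R - 2 * m%:R - 1 :> R.
    by rewrite natrB // -natr1 natrM; ring.
  by rewrite e1 e2; field.
have ed : d = (2 * m)%N by lia.
by rewrite ed subnn mulr0 mul0r natrM; field.
Qed.

Lemma pochhammer_nat (K m : nat) :
  pochhammer (K.+1%:R : R) m * K`!%:R = (K + m)`!%:R.
Proof.
elim: m => [|m IHm]; first by rewrite /pochhammer big_ord0 mul1r addn0.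
rewrite pochhammerS mulrAC IHm addnS factS natrM mulrC; congr (_ * _).
by rewrite -natrD; congr (_%:R); lia.
Qed.

(* The coefficient of [z^K] in [(z^-1 + 1 + z)^N]. *)
Definition trinomial (N K : nat) : nat :=
  \sum_(m < N.+1) 'C(N, K + 2 * m) * 'C(K + 2 * m, m).

Lemma trinomial_small N K : (N < K)%N -> trinomial N K = 0%N.
Proof.
by move=> lt_NK; rewrite /trinomial big1 // => m _; rewrite bin_small // ltn_addr.
Qed.

Lemma trinomial_diag N : trinomial N N = 1%N.
Proof.
rewrite /trinomial big_ord_recl muln0 addn0 bin0 binn big1 // => m _.
by rewrite lift0 bin_small //; lia.
Qed.

(** Both sides are [N! (K + 1) / ((N - K - 2 m)! m! (K + m + 1)!)]. The right side counts Motzkin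
    paths of length [N] to height [K] with [m] down steps: a choice of the non-level steps times a
    ballot number. *)
Lemma hyp2F1_term (N K m : nat) : (K <= N)%N ->
  'C(N, K)%:R * (((N - K) ^_ (2 * m))%:R / (pochhammer (K.+2%:R : R) m * m`!%:R))
  = 'C(N, K + 2 * m)%:R * ('C(K + 2 * m, m)%:R * (K.+1%:R / (K + m).+1%:R)).
Proof.
move=> le_KN.
have nz k : k`!%:R != 0 :> R by rewrite pnatr_eq0 -lt0n fact_gt0.
have pE : pochhammer (K.+2%:R : R) m = (K + m).+1`!%:R / K.+1`!%:R.
  by rewrite -addSn -pochhammer_nat mulfK.
have [lt|le] := ltnP (N - K) (2 * m).
  by rewrite ffact_small // [in RHS]bin_small ?mul0r ?mulr0 //; lia.
have ffE : ((N - K) ^_ (2 * m))%:R = (N - K)`!%:R / (N - K - 2 * m)`!%:R :> R.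
  by rewrite -(ffact_fact le) natrM mulfK.
have bE n k : (k <= n)%N -> 'C(n, k)%:R = n`!%:R / (k`!%:R * (n - k)`!%:R) :> R.
  by move=> le_kn; rewrite -(bin_fact le_kn) 2!natrM mulfK // mulf_neq0.
rewrite pE ffE !bE //; try lia.
have -> : (K + 2 * m - m = K + m)%N by lia.
have -> : (N - (K + 2 * m) = N - K - 2 * m)%N by lia.
rewrite !factS !natrM.
have := nz (K + m)%N; have := nz m; have := nz K; have := nz (N - K)%N.
have := nz (N - K - 2 * m)%N; have := nz (K + 2 * m)%N.
have : K.+1%:R != 0 :> R by rewrite pnatr_eq0.
have : (K + m).+1%:R != 0 :> R by rewrite pnatr_eq0.
by move=> *; field; do !(apply/andP; split).
Qed.

Lemma binomial_hyp2F1 (N K : nat) :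
  'C(N, K)%:R * hyp2F1 ((K%:R - N%:R) / 2) ((K%:R - N%:R + 1) / 2) (K.+2%:R) (4 : R)
  = \sum_(m < N.+1) 'C(N, K + 2 * m)%:R * ('C(K + 2 * m, m)%:R * (K.+1%:R / (K + m).+1%:R)).
Proof.
(* For [N < K] the series need not terminate, but the binomial prefactor is 0. *)
have [lt_NK|le_KN] := ltnP N K.
  rewrite bin_small // mul0r big1 // => m _.
  by rewrite bin_small ?mul0r // ltn_addr.
have dE : K%:R - N%:R = - (N - K)%:R :> R by rewrite natrB // opprB.
have tE m : pochhammer ((K%:R - N%:R) / 2 : R) m * pochhammer ((K%:R - N%:R + 1) / 2 : R) m
     / (pochhammer (K.+2%:R : R) m * m`!%:R) * 4 ^+ m
   = ((N - K) ^_ (2 * m))%:R / (pochhammer (K.+2%:R : R) m * m`!%:R).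
  by rewrite mulrAC dE pochhammer_half.
rewrite /hyp2F1 (limn_series_eventually0 (N := N.+1)) => [|m lt_Nm].
  rewrite big_distrr /=; apply: eq_bigr => m _.
  by rewrite tE hyp2F1_term.
by rewrite tE ffact_small ?mul0r //; lia.
Qed.

(** The reflection formula for ballot numbers; at [m = 0] there is nothing to subtract. *)
Lemma ballotE (K m : nat) :
  'C(K + 2 * m, m)%:R * (K.+1%:R / (K + m).+1%:R)
  = 'C(K + 2 * m, m)%:R - (if m is m'.+1 then 'C(K + 2 * m, m') else 0%N)%:R :> R.
Proof.
case: m => [|m].
  by rewrite subr0 addn0 divff ?mulr1 // pnatr_eq0.
have := mul_bin_left (K + 2 * m.+1) m.
have -> : (K + 2 * m.+1 - m = (K + m.+1).+1)%N by lia.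
move/(congr1 (fun n => n%:R : R)); rewrite !natrM => e.
have nz : (K + m.+1).+1%:R != 0 :> R by rewrite pnatr_eq0.
apply: (mulIf nz); rewrite mulrBl [X in _ - X]mulrC -e.
rewrite mulrA mulfVK // [X in _ - X]mulrC -mulrBr; congr (_ * _).
by rewrite -natrB; [congr (_%:R); lia | lia].
Qed.

Lemma h_odd (N K : nat) :
  h R N.+1 (2 * K).+1 = (trinomial N K)%:R - (trinomial N K.+2)%:R.
Proof.
rewrite /h.
have -> : uphalf (2 * K).+1 = K.+1 by lia.
have -> : odd (2 * K).+1 by lia.
rewrite !subn1 /=.
have -> : K.+1%:R - N.+1%:R = K%:R - N%:R :> R by rewrite -!natr1; ring.
rewrite natr1 binomial_hyp2F1.
under eq_bigr => m _ do rewrite ballotE mulrBr -!natrM.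
rewrite sumrB -!natr_sum; congr (_ - _%:R).
(* Term [m + 1] of the subtracted sum is term [m] of [trinomial N K.+2], whose last term is 0. *)
rewrite /trinomial [LHS]big_ord_recl /= muln0 add0n [RHS]big_ord_recr /=.
have -> : 'C(N, K.+2 + 2 * N) = 0%N by apply: bin_small; lia.
rewrite mul0n addn0.
apply: eq_bigr => m _; rewrite /bump leq0n add1n.
by have -> : (K + 2 * m.+1 = K.+2 + 2 * m)%N by lia.
Qed.

(** The absorption identities [e1] and [e2] take the prefactor into the binomials and cancel the
    denominator [K + m + 1]. *)
Lemma h_even (N K : nat) :
  h R N.+1 (2 * K).+2 = (K.+1 * trinomial N K.+1)%:R.
Proof.
rewrite /h.
have -> : uphalf (2 * K).+2 = K.+1 by lia.
have -> : odd (2 * K).+2 = false by lia.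
rewrite !subn1 /=; case: N => [|N].
  by rewrite mul0n mul0r trinomial_small // muln0.
rewrite subn2 /=.
have -> : K.+1%:R - N.+2%:R + 1 = K%:R - N%:R :> R by rewrite -!natr1; ring.
have -> : K.+1%:R - N.+2%:R + 2 = K%:R - N%:R + 1 :> R by rewrite -!natr1; ring.
rewrite natr1 natrM -mulrA binomial_hyp2F1.
rewrite natrM /trinomial [in RHS]big_ord_recr /=.
have -> : 'C(N.+1, K.+1 + 2 * N.+1) = 0%N by apply: bin_small; lia.
rewrite mul0n addn0 natr_sum !big_distrr /=; apply: eq_bigr => m _.
have nz : (K + m).+1%:R != 0 :> R by rewrite pnatr_eq0.
have e1 : N.+1%:R * 'C(N, K + 2 * m)%:R = (K + 2 * m).+1%:R * 'C(N.+1, (K + 2 * m).+1)%:R :> R.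
  by rewrite -!natrM mul_bin_diag.
have e2 : (K + 2 * m).+1%:R * 'C(K + 2 * m, m)%:R = (K + m).+1%:R * 'C((K + 2 * m).+1, m)%:R :> R.
  have := mul_bin_down (K + 2 * m).+1 m => /=.
  have -> : ((K + 2 * m).+1 - m = (K + m).+1)%N by lia.
  by move/(congr1 (fun n => n%:R : R)); rewrite !natrM => ->.
rewrite addSn natrM.
transitivity (N.+1%:R * 'C(N, K + 2 * m)%:R * 'C(K + 2 * m, m)%:R
  * K.+1%:R / (K + m).+1%:R : R); first by ring.
rewrite e1 -mulrA.
transitivity ('C(N.+1, (K + 2 * m).+1)%:R
  * ((K + 2 * m).+1%:R * 'C(K + 2 * m, m)%:R) * K.+1%:R / (K + m).+1%:R : R).
  by ring.
by rewrite e2; field; rewrite ?nz.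
Qed.
End Entries.

(** * Factoring out the unitriangular matrix of trinomial coefficients *)

Section Factorization.
Variables (R : realType) (n : nat).

Lemma sum_mul_delta (N c : nat) (F : nat -> R) :
  \sum_(j < N) F j * (j == c :> nat)%:R = if (c < N)%N then F c else 0.
Proof.
case: ifP => [lt_cN|nlt_cN].
  rewrite (bigD1 (Ordinal lt_cN)) //= eqxx mulr1 big1 ?addr0 // => j.
  by rewrite -val_eqE /= => /negbTE ->; rewrite mulr0.
rewrite big1 // => j _; case: eqP => [e|_]; last by rewrite mulr0.
by rewrite -e ltn_ord in nlt_cN.
Qed.

Definition trinomial_mx : 'M[R]_(2 * n) := \matrix_(i, j) (trinomial i j)%:R.
(** Taking [2 n] columns of each parity covers all nonzero columns of [H(2n)], by [h_small]. *)
Definition H_odd : 'M[R]_(2 * n) := \matrix_(i, k) h R i.+1 (2 * k).+1.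
Definition H_even : 'M[R]_(2 * n) := \matrix_(i, k) h R i.+1 (2 * k).+2.

(** The index [k + 1] or [k + 2] in a column of [chebY] or [chebX] may leave the matrix; the missing
    coefficient is then 0, so the factorization stays exact. *)
Lemma trinomial_oob (i : 'I_(2 * n)) K :
  (if (K < 2 * n)%N then (trinomial i K)%:R else 0) = (trinomial i K)%:R :> R.
Proof.
case: ltnP => // le_nK; rewrite trinomial_small //.
exact: leq_trans (ltn_ord i) le_nK.
Qed.

Lemma H_oddE : H_odd = trinomial_mx *m chebX n R.
Proof.
apply/matrixP => i k; rewrite !mxE h_odd.
under eq_bigr => j _ do rewrite !mxE mulrBr.
by rewrite sumrB !(sum_mul_delta _ _ (fun j => (trinomial i j)%:R)) !trinomial_oob.
Qed.

Lemma H_evenE : H_even = trinomial_mx *m chebY n R.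
Proof.
apply/matrixP => i k; rewrite !mxE h_even.
under eq_bigr => j _ do rewrite !mxE natrM mulrCA.
rewrite -big_distrr /= (sum_mul_delta _ _ (fun j => (trinomial i j)%:R)).
by rewrite trinomial_oob natrM.
Qed.

Lemma det_trinomial_mx : \det trinomial_mx = 1.
Proof.
rewrite det_trig; last first.
  by apply/is_trig_mxP => i j lt_ij; rewrite mxE trinomial_small.
by rewrite big1 // => i _; rewrite mxE trinomial_diag.
Qed.

Lemma det_pair_cols_H (f : 'I_n -> 'I_(2 * n)) :
  \det (pair_cols H_odd H_even f) = \det (pair_cols (chebX n R) (chebY n R) f).
Proof. by rewrite H_oddE H_evenE pair_cols_mulmx det_mulmx det_trinomial_mx mul1r. Qed.

Lemma h_small N j : (2 * N.+1 < j)%N -> h R N.+1 j = 0.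
Proof.
move=> lt_Nj; case: (boolP (odd j)) => oj.
  have -> : j = (2 * j./2).+1 by lia.
  by rewrite h_odd !trinomial_small ?subrr //; lia.
have -> : j = (2 * (j./2).-1).+2 by lia.
by rewrite h_even trinomial_small ?muln0 //; lia.
Qed.

End Factorization.

(** * Partitions with even parts and even conjugate as increasing selections *)

Section Partitions.

Lemma nth_partition_anti (l : seq nat) i j :
  sorted geq l -> (i <= j)%N -> (nth 0 l j <= nth 0 l i)%N.
Proof.
move=> sl le_ij; case: (ltnP j (size l)) => [lt_j|]; last by move/(nth_default 0%N) ->.
have geq_trans : transitive geq by move=> x y z le1 le2; apply: leq_trans le2 le1.
apply: (sorted_leq_nth geq_trans (fun x => leqnn x) 0%N sl) => //.
by rewrite inE (leq_ltn_trans le_ij).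
Qed.

(** Transposition of the Young diagram, with parts indexed from 0. *)
Lemma leq_nth_count (l : seq nat) i j : sorted geq l -> (0 < i)%N ->
  (i <= nth 0 l j)%N = (j < count (leq i) l)%N.
Proof.
move=> + i_gt0; elim: l j => [|x l IHl] j sl; first by rewrite nth_nil leqNgt i_gt0.
have sl' : sorted geq l by apply: path_sorted sl.
rewrite [count _ _]/=; case: (leqP i x) => [le_ix|lt_xi].
  by case: j => [|j] //=; rewrite add1n ltnS IHl.
rewrite add0n; have le_x k : (nth 0 l k <= x)%N.
  exact: (@nth_partition_anti (x :: l) 0 k.+1).
have -> : (i <= nth 0 (x :: l) j)%N = false.
  by case: j => [|j] /=; apply/negbTE; rewrite -ltnNge // (leq_ltn_trans (le_x j)).
apply/esym/negbTE; rewrite -leqNgt; apply: leq_trans (leq0n j).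
by rewrite leqNgt -IHl // -ltnNge (leq_ltn_trans (le_x 0%N)).
Qed.

Lemma even_conjugateP (l : seq nat) : sorted geq l ->
  reflect (forall j, nth 0 l (2 * j) = nth 0 l (2 * j).+1)%N
    (even_partition (conjugate l)).
Proof.
move=> sl; apply: (iffP allP) => [evenl j|eql c /mapP[i]].
  apply/eqP; rewrite eqn_leq (nth_partition_anti (i := 2 * j)) // andbT.
  set i := nth _ _ _; case: (posnP i) => [->//|i_gt0].
  have in_l : i \in iota 1 (head 0%N l).
    by rewrite mem_iota i_gt0 add1n ltnS -nth0 nth_partition_anti.
  (* The number of parts [>= i] exceeds [2 j] and is even, hence exceeds [2 j + 1]. *)
  have := evenl _ (map_f (fun i => count (leq i) l) in_l).
  have := leq_nth_count (2 * j) sl i_gt0; rewrite leqnn.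
  rewrite leq_nth_count //; lia.
(* An odd count [c] would separate the parts at [c - 1] and [c], which are equal. *)
rewrite mem_iota => /andP[i_gt0 _] ->; apply/negP => odd_c.
have := leq_nth_count (2 * (count (leq i) l)./2) sl i_gt0.
rewrite eql leq_nth_count //; lia.
Qed.

(** The zeros stand at the end, where [nth] returns the default 0 anyway. *)
Lemma nth_filter_pos (l : seq nat) i :
  sorted geq l -> nth 0%N [seq x <- l | leq 1 x] i = nth 0%N l i.
Proof.
elim: l i => [|x l IHl] i sl //=.
have sl' : sorted geq l by apply: path_sorted sl.
case: x sl => [|x] sl /=; last by case: i => [|i] //=; apply: IHl.
have l0 k : nth 0%N l k = 0%N.
  by apply/eqP; rewrite -leqn0; apply: (@nth_partition_anti (0 :: l)%N 0 k.+1).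
rewrite IHl // l0; by case: i => [|i] /=; rewrite ?l0.
Qed.

Lemma eq_positive_seq (l l' : seq nat) : all (leq 1) l -> all (leq 1) l' ->
  (forall i, nth 0 l i = nth 0 l' i)%N -> l = l'.
Proof.
elim: l l' => [|x l IHl] [|x' l'] //=.
- by move=> _ /andP[x'_gt0 _] /(_ 0%N) /= e; rewrite -e in x'_gt0.
- by move=> /andP[x_gt0 _] _ /(_ 0%N) /= e; rewrite e in x_gt0.
move=> /andP[_ l_gt0] /andP[_ l'_gt0] e; rewrite (e 0%N : x = x').
by congr (_ :: _); apply: IHl => // i; apply: (e i.+1).
Qed.

(** The index list is already nondecreasing, so sorting leaves it alone. *)
Lemma nth_sort_index_set N l s : sorted geq l -> (s < N)%N ->
  nth 0%N (sort leq (index_set N l)) s = (nth 0 l (N - s.+1) + s.+1)%N.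
Proof.
move=> sl lt_sN; rewrite sorted_sort; last 2 first.
- exact: leq_trans.
- apply: (homo_sorted (e := leq)); last exact: iota_sorted.
  by move=> i j le_ij; apply: leq_add => //; apply: nth_partition_anti => //; apply: leq_sub2l.
by rewrite (nth_map 0%N) ?size_iota // nth_iota // add1n.
Qed.

Variables (n : nat).

Lemma increasing_geq m (f : 'I_n -> 'I_m) (t : 'I_n) : increasing f -> (t <= f t)%N.
Proof.
move/increasingP=> incf; case: t => t; elim: t => // t IHt lt_tn.
apply: leq_ltn_trans (IHt (ltnW lt_tn)) _.
exact: incf.
Qed.

(** Each step raises [f] by at least 1; this makes the parts of [partition_of f] nonincreasing. *)
Lemma increasing_sub m (f : 'I_n -> 'I_m) (t u : 'I_n) :
  increasing f -> (t <= u)%N -> (f t - t <= f u - u)%N.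
Proof.
move=> incf; have [d le_d] := ubnP (u - t)%N; elim: d u le_d => // d IHd [u lt_un] le_d le_tu.
move: le_tu; rewrite leq_eqVlt => /orP[/eqP e|lt_tu].
  by have -> : t = Ordinal lt_un by apply: val_inj.
case: u lt_un le_d lt_tu => // u lt_un le_d lt_tu.
have lt_un' := ltnW lt_un.
apply: (leq_trans (IHd (Ordinal lt_un') _ _)) => //=; first by move: le_d lt_tu => /=; lia.
have /increasingP/(_ (Ordinal lt_un') (Ordinal lt_un) (ltnSn _)) := incf.
lia.
Qed.

(* The partition with both [lambda_(2 (n - t))] and [lambda_(2 (n - t) - 1)]
   equal to [2 (f t - t)], so that the index set consists of the pairs
   [2 f t + 1, 2 f t + 2]. *)
Definition partition_of m (f : 'I_n -> 'I_m) : seq nat :=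
  [seq x <- [seq (2 * (f (rev_ord (half_ord i)) - rev_ord (half_ord i)))%N
            | i <- enum 'I_(2 * n)] | leq 1 x].

Lemma unfiltered_partition_of_sorted m (f : 'I_n -> 'I_m) : increasing f ->
  sorted geq [seq (2 * (f (rev_ord (half_ord i)) - rev_ord (half_ord i)))%N
             | i <- enum 'I_(2 * n)].
Proof.
move=> incf.
rewrite sorted_map; apply: (sub_sorted (e := fun i j : 'I_(2 * n) => (i < j)%N)).
  move=> i j lt_ij; rewrite /geq /= leq_mul2l.
  apply: (increasing_sub (t := rev_ord (half_ord j)) (u := rev_ord (half_ord i))) => //=.
  by move: lt_ij (ltn_ord j) => /=; lia.
by have := iota_ltn_sorted 0 (2 * n); rewrite -val_enum_ord sorted_map.
Qed.

Lemma partition_of_sorted m (f : 'I_n -> 'I_m) : increasing f ->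
  sorted geq (partition_of f).
Proof.
move=> incf; apply: sorted_filter; last exact: unfiltered_partition_of_sorted.
by move=> x y z le1 le2; apply: leq_trans le2 le1.
Qed.

Lemma nth_partition_of m (f : 'I_n -> 'I_m) (i : 'I_(2 * n)) : increasing f ->
  nth 0%N (partition_of f) i
  = (2 * (f (rev_ord (half_ord i)) - rev_ord (half_ord i)))%N.
Proof.
move=> incf; rewrite nth_filter_pos ?unfiltered_partition_of_sorted //.
by rewrite (nth_map i) ?size_enum_ord // nth_ord_enum.
Qed.

Lemma size_partition_of m (f : 'I_n -> 'I_m) : (size (partition_of f) <= 2 * n)%N.
Proof. by rewrite size_filter (leq_trans (count_size _ _)) // size_map size_enum_ord. Qed.

Lemma nth_partition_of_dbl m (f : 'I_n -> 'I_m) (t : 'I_n) b : increasing f ->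
  nth 0%N (partition_of f) (2 * n - (dbl t b).+1) = (2 * (f t - t))%N.
Proof.
move=> incf; rewrite (nth_partition_of (rev_ord (dbl t b)) incf).
suff -> : rev_ord (half_ord (rev_ord (dbl t b))) = t by [].
by apply/val_inj => /=; case: b (ltn_ord t) => /=; lia.
Qed.

Lemma partition_ofP m (f : 'I_n -> 'I_m) : increasing f ->
  [/\ is_partition (partition_of f), (size (partition_of f) <= 2 * n)%N,
      even_partition (partition_of f) & even_partition (conjugate (partition_of f))].
Proof.
move=> incf; split.
- by rewrite /is_partition partition_of_sorted // filter_all.
- exact: size_partition_of.
- apply/(all_nthP 0%N) => i lt_i.
  have lt_in : (i < 2 * n)%N by exact: leq_trans lt_i (size_partition_of f).
  by rewrite (nth_partition_of (Ordinal lt_in) incf) oddM.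
apply/even_conjugateP; first exact: partition_of_sorted.
move=> j; case: (ltnP j n) => [lt_jn|le_nj]; last first.
  by rewrite !nth_default //; apply: leq_trans (size_partition_of f) _; lia.
have lt0 : (2 * j < 2 * n)%N by lia.
have lt1 : ((2 * j).+1 < 2 * n)%N by lia.
rewrite (nth_partition_of (Ordinal lt0) incf) (nth_partition_of (Ordinal lt1) incf).
suff -> : half_ord (Ordinal lt0) = half_ord (Ordinal lt1) by [].
by apply/val_inj => /=; lia.
Qed.

Lemma partition_of_inj m (f g : 'I_n -> 'I_m) : increasing f -> increasing g ->
  partition_of f = partition_of g -> f =1 g.
Proof.
move=> incf incg eq_fg t; apply/val_inj => /=.
have := nth_partition_of_dbl t false incf; rewrite eq_fg nth_partition_of_dbl //.
by move: (increasing_geq t incf) (increasing_geq t incg); lia.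
Qed.

Lemma partition_of_surj m (l : seq nat) : (head 0%N l <= 2 * (m - n))%N -> (n <= m)%N ->
    is_partition l -> (size l <= 2 * n)%N -> even_partition l ->
    even_partition (conjugate l) ->
  exists2 f : {ffun 'I_n -> 'I_m}, increasing f & partition_of f = l.
Proof.
move=> le_l le_nm /andP[sl l_gt0] le_size even_l /(even_conjugateP sl) eql.
(* This solves [2 (f t - t) = lambda_(2 (n - t))] for [f t]; the bound on the first part keeps the
   value below [m]. *)
pose g t := ((nth 0 l (2 * n - (2 * t).+1))./2 + t)%N.
have g_lt (t : 'I_n) : (g t < m)%N.
  have := @nth_partition_anti l 0 (2 * n - (2 * t).+1) sl (leq0n _).
  by rewrite nth0 /g; move: (ltn_ord t); lia.
pose f := [ffun t : 'I_n => Ordinal (g_lt t)].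
have incf : increasing f.
  apply/increasingP => t u lt_tu; rewrite !ffunE /= /g.
  have := @nth_partition_anti l (2 * n - (2 * u).+1) (2 * n - (2 * t).+1) sl.
  by move: (ltn_ord u); lia.
exists f => //; apply: eq_positive_seq => // [|i]; first exact: filter_all.
case: (ltnP i (2 * n)) => [lt_in|le_ni]; last first.
  rewrite !nth_default ?(leq_trans le_size) //.
  exact: leq_trans (size_partition_of f) le_ni.
rewrite (nth_partition_of (Ordinal lt_in) incf) ffunE /= /g addnK.
have -> : (2 * n - (2 * (n - i./2.+1)).+1 = (2 * i./2).+1)%N by lia.
rewrite -eql; have -> : nth 0%N l i = nth 0%N l (2 * i./2).
  case: (boolP (odd i)) => oi; last by congr nth; lia.
  by rewrite eql; congr nth; lia.
case: (ltnP (2 * i./2) (size l)) => [lt_i|le_i]; last by rewrite nth_default.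
by have := allP even_l _ (mem_nth 0%N lt_i); lia.
Qed.

End Partitions.

(** * From partition minors to paired minors *)

Lemma subcols_H (R : realType) n (f : 'I_n -> 'I_(2 * n)) : increasing f ->
  subcols (H R (N := 2 * n)) (index_set (2 * n) (partition_of f))
  = pair_cols (H_odd R n) (H_even R n) f.
Proof.
move=> incf; apply/matrixP => r s; rewrite !mxE /H.
rewrite nth_sort_index_set ?partition_of_sorted //.
rewrite -[in X in (2 * n - X)%N](dbl_half_ord s) nth_partition_of_dbl //.
(* Position [s = 2 t + b] holds column [2 (f t - t) + s + 1 = 2 f t + b + 1]; [t <= f t] makes the
   subtraction exact. *)
have := increasing_geq (half_ord s) incf => /= le_s.
by case: ifP => os; rewrite mxE; congr h; lia.
Qed.

(** The last selected column is number [lambda_1 + 2 n > 4 n], where all rows are 0. *)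
Lemma det_subcols_H_large (R : realType) n (l : seq nat) : (0 < n)%N ->
    sorted geq l -> (2 * n < head 0 l)%N ->
  \det (subcols (H R (N := 2 * n)) (index_set (2 * n) l)) = 0.
Proof.
move=> n_gt0 sl lt_nl.
have lt_s : ((2 * n).-1 < 2 * n)%N by lia.
rewrite (expand_det_col _ (Ordinal lt_s)) big1 // => r _.
rewrite mxE /H nth_sort_index_set //= h_small ?mul0r //.
have -> : (2 * n - (2 * n).-1.+1 = 0)%N by lia.
by rewrite nth0; move: (ltn_ord r); lia.
Qed.

Theorem theorem6 (R : realType) (n : nat) (n_gt0 : (0 < n)%N) :
  \sum_(l \in [set l : seq nat |
                [/\ is_partition l, (size l <= 2 * n)%N,
                    even_partition l & even_partition (conjugate l)]]%classic)
     \det (subcols (H R (N := 2 * n)) (index_set (2 * n) l))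
  = \prod_(0 <= k < n) (4 * k + 1)%:R.
Proof.
pose incs := [seq f : {ffun 'I_n -> 'I_(2 * n)} <- enum predT | increasing f].
(* The index set is infinite. The sum reduces to a duplicate-free list inside the set that contains
   every partition with a nonzero minor. *)
rewrite (fsbigE (map (fun f : {ffun _ -> _} => partition_of f) incs)) /=.
- rewrite big_map big_filter_cond big_enum_cond /= -sum_det_cheb.
  apply: eq_big => [f|f /andP[incf _]].
    by rewrite andb_idr // => incf; rewrite inE /=; apply: partition_ofP.
  by rewrite subcols_H // det_pair_cols_H.
- rewrite map_inj_in_uniq => [|f g]; first exact: filter_uniq (enum_uniq _).
  rewrite !mem_filter => /andP[incf _] /andP[incg _] eq_fg.
  exact/ffunP/partition_of_inj.
- move=> l /= /mapP[f]; rewrite mem_filter => /andP[incf _] ->.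
  exact: partition_ofP.
move=> l [part_l size_l even_l even_l'].
(* A partition outside the list must have first part above [2 n = 2 (2 n - n)], since the others
   come from selections. *)
case: (leqP (head 0%N l) (2 * n)) => [le_l|lt_l]; last first.
  by rewrite det_subcols_H_large //; case/andP: part_l.
case/negP.
have [||f incf <-] := @partition_of_surj n (2 * n) l _ _ part_l size_l even_l even_l'.
- by lia.
- by lia.
by apply/mapP; exists f => //; rewrite mem_filter incf mem_enum.
Qed.
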